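(* There exists an $\mathbb{N}$-barrycade of infinite height, that is, there exists an infinite sequence $(\mu_1,\mu_2,\mu_3,\ldots)$ of permutations of $\mathbb{N}$ such that $S_{\mu_i}\cap S_{\mu_j}=\emptyset$ for all $i\neq j$.
   Context: $\mathbb{N}$ denotes the set of positive integers. A permutation of $\mathbb{N}$ is an infinite sequence $\mu=(a_1,a_2,a_3,\ldots)$ of positive integers in which every positive integer appears exactly once (i.e. $i\mapsto a_i$ is a bijection $\mathbb{N}\to\mathbb{N}$). Its set of partial sums is $S_\mu=\{a_1,\ a_1+a_2,\ a_1+a_2+a_3,\ \ldots\}$. An $\mathbb{N}$-barrycade (of infinite height) is an infinite collection $(\mu_1,\mu_2,\mu_3,\ldots)$ of permutations of $\mathbb{N}$ such that $S_{\mu_i}\cap S_{\mu_j}=\emptyset$ for all $i\neq j$. *)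

(* Defs.v *)
From mathcomp Require Import all_boot.
From mathcomp Require Import classical_sets functions.

Set Implicit Arguments.
Unset Strict Implicit.
Unset Printing Implicit Defensive.

Local Open Scope classical_set_scope.

(* Sequences are indexed from 0: the terms a_1, a_2, ... are a 0, a 1, ...,
   while their values range over the positive integers.                       *)
Definition is_posperm (a : nat -> nat) : Prop :=
  set_bij [set: nat] [set n : nat | 0 < n] a.

(* The sums start with a 0: the empty sum is not a partial sum. *)
Definition partial_sums (a : nat -> nat) : set nat :=
  [set s | exists n : nat, s = \sum_(k < n.+1) a k].

Definition is_infinite_barrycade (mu : nat -> nat -> nat) : Prop :=
  (forall i, is_posperm (mu i)) /\
  (forall i j, i <> j -> partial_sums (mu i) `&` partial_sums (mu j) = set0).

(* Main.v *)
Require Import Defs.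
From mathcomp Require Import all_boot.
From mathcomp Require Import classical_sets functions.
From mathcomp Require Import zify.

Set Implicit Arguments.
Unset Strict Implicit.
Unset Printing Implicit Defensive.

(** If [f] grows fast, there is a permutation whose partial sums all lie in
    the windows [[f k, 4 f k[]: the k-th block of two terms consists of a large
    term raising the sum to [f k] exactly, followed by [k+1], or by another
    fresh term if [k+1] already occurs.  Taking [f k = 8 ^ (2 ^ i * (2 k + 1))]
    for the i-th permutation makes the windows of distinct permutations
    disjoint. *)

Section Block.

Variable f : nat -> nat.

Definition large_term (k : nat) (s : seq nat) : nat := f k - sumn s.

(** The fallback sits just above the large term, which will exceed all earlier terms, so it is fresh
    as well. *)
Definition small_term (k : nat) (s : seq nat) : nat :=
  if k.+1 \in s then (large_term k s).+1 else k.+1.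

Fixpoint blocks (k : nat) : seq nat :=
  if k is k'.+1 then
    blocks k' ++ [:: large_term k' (blocks k'); small_term k' (blocks k')]
  else [::].

Definition block_perm (m : nat) : nat := nth 0 (blocks m./2.+1) m.

Lemma size_blocks k : size (blocks k) = k.*2.
Proof. by elim: k => //= k IHk; rewrite size_cat IHk /= addn2 doubleS. Qed.

(** Later blocks are only appended, so a position keeps its value once it is filled. *)
Lemma nth_blocks k m : m < k.*2 -> nth 0 (blocks k) m = block_perm m.
Proof.
elim: k => // k IHk; rewrite doubleS => lt_m.
have [lt_mk | le_km] := ltnP m k.*2.
  by rewrite /= nth_cat size_blocks lt_mk IHk.
by rewrite /block_perm; have -> : m./2 = k by lia.
Qed.

Lemma mkseq_block_perm k : mkseq block_perm k.*2 = blocks k.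
Proof.
apply: (@eq_from_nth _ 0); rewrite size_mkseq ?size_blocks // => m lt_m.
by rewrite nth_mkseq // nth_blocks.
Qed.

Lemma sum_block_perm k : \sum_(j < k.*2) block_perm j = sumn (blocks k).
Proof.
rewrite -mkseq_block_perm sumnE big_map.
by rewrite -(big_mkord xpredT) /index_iota subn0.
Qed.

Lemma block_perm_large k : block_perm k.*2 = large_term k (blocks k).
Proof.
by rewrite /block_perm doubleK /= nth_cat size_blocks ltnn subnn.
Qed.

Lemma block_perm_small k : block_perm k.*2.+1 = small_term k (blocks k).
Proof.
rewrite /block_perm; have -> : (k.*2.+1)./2 = k by lia.
by rewrite /= nth_cat size_blocks ltnNge leqnSn /= subSnn.
Qed.

Hypothesis f0_gt1 : 1 < f 0.
Hypothesis f_growth : forall k, 8 * f k <= f k.+1.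

Lemma f_gt_index k : k.+1 < f k.
Proof. by elim: k => // k IHk; have := f_growth k; lia. Qed.

Lemma small_term_le k s : small_term k s <= (f k).+1.
Proof.
by have := f_gt_index k; rewrite /small_term /large_term; case: ifP; lia.
Qed.

(** Block [k] ends at a sum of at most [2 * f k + 1], and the growth factor 8 absorbs its double.
    The first bound puts the large term above all earlier terms, the second above [k.+1]. *)
Lemma sumn_blocks_bound k :
  2 * sumn (blocks k) < f k /\ sumn (blocks k) + k.+1 < f k.
Proof.
elim: k => [|k [IH2 IHk]] /=; first by lia.
rewrite sumn_cat /= addn0 /large_term.
have := small_term_le k (blocks k); have := f_growth k.
by have := f_gt_index k; lia.
Qed.

Lemma large_term_gt k :
  sumn (blocks k) < large_term k (blocks k) /\
  k.+1 < large_term k (blocks k).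
Proof. by rewrite /large_term; have := sumn_blocks_bound k; lia. Qed.

Lemma leq_sumn (s : seq nat) x : x \in s -> x <= sumn s.
Proof.
elim: s => //= y s IHs; rewrite inE => /orP[/eqP-> | /IHs]; lia.
Qed.

Lemma blocks_uniq k : uniq (blocks k).
Proof.
elim: k => //= k IHk; have [gt_sum gt_k] := large_term_gt k.
(* Every earlier term is at most the sum of all of them. *)
have fresh y : sumn (blocks k) < y -> y \notin blocks k.
  by move=> gt_y; apply: contraL gt_y => /leq_sumn; rewrite -leqNgt.
rewrite cat_uniq IHk /= orbF inE !andbT negb_or fresh //=.
rewrite /small_term; case: ifP => [_ | /negbT k_notin].
  by rewrite fresh ?(leqW gt_sum) //= neq_ltn leqnn.
by rewrite k_notin neq_ltn gt_k orbT.
Qed.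

Lemma blocks_gt0 k : all (leq 1) (blocks k).
Proof.
elim: k => //= k IHk; have [gt_sum _] := large_term_gt k.
rewrite all_cat IHk /= andbT (leq_ltn_trans _ gt_sum) //=.
by rewrite /small_term; case: ifP.
Qed.

Lemma mem_blocks k : k.+1 \in blocks k.+1.
Proof.
rewrite /= mem_cat !inE /small_term; case: ifP => //= _.
by rewrite eqxx orbT.
Qed.

Lemma block_perm_is_posperm : is_posperm block_perm.
Proof.
split.
- move=> m _ /=; rewrite -(@nth_blocks m.+1); last by lia.
  by apply: (allP (blocks_gt0 m.+1)); rewrite mem_nth // size_blocks; lia.
(* Both positions lie in one common prefix, whose terms are distinct. *)
- move=> m n _ _; pose k := (maxn m n).+1.
  have [lt_m lt_n] : m < k.*2 /\ n < k.*2 by rewrite /k; lia.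
  rewrite -(nth_blocks lt_m) -(nth_blocks lt_n) => /eqP.
  by rewrite nth_uniq ?size_blocks ?blocks_uniq // => /eqP.
- move=> [//|k] _ /=; have /(nthP 0)[m lt_m <-] := mem_blocks k.
  by exists m => //; rewrite nth_blocks // -size_blocks.
Qed.

Lemma partial_sums_block_perm s :
  partial_sums block_perm s -> exists k, f k <= s < 4 * f k.
Proof.
move=> [n ->]; exists n./2; set k := n./2.
have [lt2 _] := sumn_blocks_bound k; have gt_k := f_gt_index k.
have sum_large : \sum_(j < k.*2.+1) block_perm j = f k.
  by rewrite big_ord_recr /= sum_block_perm block_perm_large /large_term; lia.
(* The sum has [n.+1] terms: for even [n] it stops at a large term, for odd [n] at a small one. *)
have [-> | ->] : n = k.*2 \/ n = k.*2.+1 by rewrite /k; lia.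
  by rewrite sum_large; lia.
rewrite big_ord_recr /= sum_large block_perm_small.
by have := small_term_le k (blocks k); lia.
Qed.

End Block.

Definition window (i k : nat) : nat := 8 ^ (2 ^ i * k.*2.+1).

Lemma window_gt1 i : 1 < window i 0.
Proof. by rewrite /window muln1 -[1](expn0 8) ltn_exp2l // expn_gt0. Qed.

(** The exponent rises by [2 ^ i.+1], hence by at least 1. *)
Lemma window_growth i k : 8 * window i k <= window i k.+1.
Proof.
rewrite /window -expnS leq_exp2l // doubleS.
by have := expn_gt0 2 i; nia.
Qed.

Lemma logn2_exponent i k : logn 2 (2 ^ i * k.*2.+1) = i.
Proof.
rewrite lognM ?expn_gt0 // pfactorK // logn_coprime ?addn0 //.
by rewrite coprime2n /= odd_double.
Qed.

(** For [p < q], the window at [q] starts at [8 * 8 ^ p] or later, beyond the end of the one at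
    [p]. *)
Lemma expn8_window p q s :
  8 ^ p <= s < 4 * 8 ^ p -> 8 ^ q <= s < 4 * 8 ^ q -> p = q.
Proof.
wlog le_pq : p q / p <= q => [hwlog sp sq | ].
  by case/orP: (leq_total p q) => le; [|symmetry]; apply: hwlog.
move=> /andP[_ lt_s] /andP[ge_s _]; apply/eqP; rewrite eqn_leq le_pq /=.
rewrite leqNgt; apply/negP => lt_pq.
have : 8 ^ p.+1 <= 8 ^ q by rewrite leq_exp2l.
by rewrite expnS; lia.
Qed.

Theorem theorem3 : exists mu : nat -> nat -> nat, is_infinite_barrycade mu.
Proof.
exists (fun i => block_perm (window i)); split=> [i | i j neq_ij].
  exact: block_perm_is_posperm (window_gt1 i) (window_growth i).
rewrite -subset0 => s [].
move=> /(partial_sums_block_perm (window_gt1 i) (window_growth i))[k sk].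
move=> /(partial_sums_block_perm (window_gt1 j) (window_growth j))[l sl].
(* A common sum forces equal exponents, and their 2-adic valuations recover [i] and [j]. *)
apply: neq_ij; rewrite -(logn2_exponent i k) -(logn2_exponent j l).
by congr logn; apply: expn8_window sk sl.
Qed.
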